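(* For any endo-span $X\xleftarrow{s}A\xrightarrow{t}X$ in $\mathcal Z$ (that is, any $\mathbb P$-span $\widehat A$ from a finite parity groupoid $X$ to itself), one has an equality of rational numbers $$ |\mathrm{Det}(\widehat A)|=\det|\widehat A| . $$
   Context: Let $O(1)=\{+1,-1\}$ and let $\mathbb P=BO(1)$ be the one-object groupoid with automorphism group $O(1)$. All groupoids are finite (finitely many isomorphism classes, finite hom sets), and pullbacks, fibres and quotients are homotopy (weak) ones. A parity structure on a groupoid $S$ is a functor $S\to\mathbb P$; it assigns to each arrow $a$ a parity $\mathrm{par}(a)\in\{\pm1\}$ (even $=+1$, odd $=-1$), multiplicatively. $\mathcal Z$ is the $2$-category of finite groupoids with parity structure (the weak slice over $\mathbb P$). $\mathsf e:1\to\mathbb P$ is the unique parity structure on the terminal groupoid. A point is orientable if it has no odd automorphism; $X^\circ\subset X$ is the full subgroupoid of orientable points. A $\mathbb P$-span from $f:S\to\mathbb P$ to $g:T\to\mathbb P$ is a span of groupoids $S\xleftarrow{p}M\xrightarrow{q}T$ with a natural isomorphism $\rho:f p\Rightarrow g q$, i.e. signs $\rho_x\in\{\pm1\}$ with $\mathrm{par}(p(a))\,\rho_{x'}=\rho_x\,\mathrm{par}(q(a))$ for each $a:x\to x'$ in $M$. A scalar is a $\mathbb P$-span from $\mathsf e$ to $\mathsf e$; its groupoid splits by sign as $S=S_\oplus\sqcup S_\ominus$, and its cardinality is $|S_\oplus|-|S_\ominus|$, where $|S|=\sum_{s\in\pi_0S}1/|\mathrm{Aut}(s)|$ for a finite groupoid.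 The two-sided fibre ${}_iM_j$ of $I\xleftarrow{p}M\xrightarrow{q}J$ is the scalar with objects $(m,a:i\to p(m),b:q(m)\to j)$ and sign $\mathrm{par}(a)\rho_m\mathrm{par}(b)$. The cardinality of a $\mathbb P$-span $I\leftarrow M\to J$ is the $\pi_0(I^\circ)$-by-$\pi_0(J^\circ)$ rational matrix with entries $|{}_iM_j|/|\mathrm{Aut}(j)|$, where $i,j$ run over a fixed choice of one base point in each orientable component. For a parity groupoid $X$, the exterior power $\Lambda^nX$ is the weak quotient groupoid $X^n/\Sigma_n$: objects are $n$-tuples in $X$; a morphism $(y_1,\dots,y_n)\to(x_1,\dots,x_n)$ consists of $\sigma\in\Sigma_n$ and arrows $\gamma_j:y_j\to x_{\sigma(j)}$, with parity $\mathrm{sign}(\sigma)\,\mathrm{par}(\gamma_1)\cdots\mathrm{par}(\gamma_n)$. For a $\mathbb P$-span $S\leftarrow M\to T$ with $2$-cell $\epsilon$, its $n$th exterior power is the $\mathbb P$-span $\Lambda^nS\leftarrow\Lambda^nM\to\Lambda^nT$, $\Lambda^nM=M^n/\Sigma_n$, with legs induced componentwise and $2$-cell having component $\epsilon_{m_1}\cdots\epsilon_{m_n}$ at $(m_1,\dots,m_n)$. If $X$ has $n$ orientable components, the determinant $\mathrm{Det}(\widehat A)$ of the endo-span $\widehat A$ is the $\mathbb P$-span $\Lambda^nX\leftarrow\Lambda^nA\to\Lambda^nX$. With $x_1,\dots,x_n$ chosen base points of the orientable components of $X$, the groupoid $(\Lambda^nX)^\circ$ is connected with base point $\underline x=(x_1,\dots,x_n)$,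 so $|\mathrm{Det}(\widehat A)|$ is a $1$-by-$1$ matrix, identified with the rational number $|{}_{\underline x}(\Lambda^nA)_{\underline x}|/|\mathrm{Aut}(\underline x)|$. On the right-hand side, $\det$ is the ordinary determinant of the $n\times n$ rational matrix $|\widehat A|$. *)

(* Defs.v *)
From mathcomp Require Import all_boot all_order all_fingroup all_algebra.
From mathcomp Require Import boolp.

Set Implicit Arguments.
Unset Strict Implicit.
Unset Printing Implicit Defensive.

Import GRing.Theory.

(* Composition is in diagrammatic order: [gcomp a b] is "a, then b".          *)

(* Groupoids that are finite up to equivalence: the objects may form an       *)
(* infinite type, but [r] meets every isomorphism class.                      *)
Record groupoid := Groupoid {
  ob :> Type;
  hom : ob -> ob -> finType;
  gid : forall x, hom x x;
  gcomp : forall x y z, hom x y -> hom y z -> hom x z;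
  ginv : forall x y, hom x y -> hom y x;
  gcompA : forall x y z t (a : hom x y) (b : hom y z) (c : hom z t),
    gcomp a (gcomp b c) = gcomp (gcomp a b) c;
  gcomp1m : forall x y (a : hom x y), gcomp (gid x) a = a;
  gcompm1 : forall x y (a : hom x y), gcomp a (gid y) = a;
  gcompVm : forall x y (a : hom x y), gcomp (ginv a) a = gid y;
  gcompmV : forall x y (a : hom x y), gcomp a (ginv a) = gid x;
  gfinite : exists (K : finType) (r : K -> ob),
    forall x, exists k, inhabited (hom (r k) x)
}.

Arguments gid {g} x.

Record functor (S T : groupoid) := Functor {
  fob :> S -> T;
  fmap : forall x y, hom x y -> hom (fob x) (fob y);
  fmap1 : forall x, fmap (gid x) = gid (fob x);
  fmapM : forall x y z (a : hom x y) (b : hom y z),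
    fmap (gcomp a b) = gcomp (fmap a) (fmap b)
}.

Arguments fmap {S T} f {x y} a.

(* All arrows being invertible, naturality suffices for an isomorphism.       *)
Record natiso (S T : groupoid) (F G : functor S T) := NatIso {
  component :> forall x, hom (F x) (G x);
  natural : forall x y (a : hom x y),
    gcomp (fmap F a) (component y) = gcomp (component x) (fmap G a)
}.

Program Definition fcomp (S T U : groupoid) (F : functor S T)
    (G : functor T U) : functor S U :=
  @Functor S U (fun x => G (F x)) (fun _ _ a => fmap G (fmap F a)) _ _.
Next Obligation. by rewrite !fmap1. Qed.
Next Obligation. by rewrite !fmapM. Qed.

Definition isomorphic (S : groupoid) (x y : S) : Prop := inhabited (hom x y).

Lemma isomorphic_refl (S : groupoid) (x : S) : isomorphic x x.
Proof. exact: inhabits (gid x). Qed.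

Lemma isomorphic_sym (S : groupoid) (x y : S) :
  isomorphic x y -> isomorphic y x.
Proof. by case=> a; exact: inhabits (ginv a). Qed.

Lemma isomorphic_trans (S : groupoid) (y x z : S) :
  isomorphic x y -> isomorphic y z -> isomorphic x z.
Proof. by case=> a [b]; exact: inhabits (gcomp a b). Qed.

(* [r] picks exactly one point in each component of [S].                      *)
Definition transversal (S : groupoid) (K : Type) (r : K -> S) : Prop :=
  forall x, exists! k, isomorphic (r k) x.

Lemma transversal_exists (S : groupoid) :
  exists (K : finType) (r : K -> S), transversal r.
Proof.
have [K [r rP]] := gfinite S.
pose e (k l : K) := `[< isomorphic (r k) (r l) >].
pose c k := odflt k [pick l | e k l].
have ec k : e k (c k).
  rewrite /c; case: pickP => //= _.
  by apply/asboolP; exact: isomorphic_refl.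
have cE k l : e k l -> c k = c l.
  move=> /asboolP kl; rewrite /c.
  have -> : [pick m | e k m] = [pick m | e l m].
    apply: eq_pick => m; apply/asboolP/asboolP; last exact: isomorphic_trans.
    exact/isomorphic_trans/isomorphic_sym.
  case: pickP => //= /(_ l) /asboolP[].
  exact: isomorphic_refl.
exists {k : K | c k == k}, (fun k => r (val k)) => x.
have [k kx] := rP x.
have cck : c (c k) == c k by rewrite -(cE _ _ (ec k)).
exists (exist _ (c k) cck); split=> /=.
  apply: isomorphic_trans kx.
  by apply: isomorphic_sym; apply/asboolP; exact: ec.
case=> l /= cl lx; apply: val_inj => /=.
rewrite -(eqP cl); apply: cE; apply/asboolP.
exact/(isomorphic_trans kx)/isomorphic_sym.
Qed.

Definition pi0 (S : groupoid) : finType := projT1 (cid (transversal_exists S)).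

Definition pi0_base (S : groupoid) : pi0 S -> S :=
  projT1 (cid (projT2 (cid (transversal_exists S)))).

Lemma pi0_baseP (S : groupoid) : transversal (@pi0_base S).
Proof. exact: projT2 (cid (projT2 (cid (transversal_exists S)))). Qed.

Definition gcard (S : groupoid) : rat :=
  (\sum_(s : pi0 S) (#|hom (pi0_base s) (pi0_base s)|%:R)^-1)%R.

Section FullSubgroupoid.
Variables (S : groupoid) (P : S -> Prop).

Lemma full_finite : exists (K : finType) (r : K -> {x : S | P x}),
  forall x : {x : S | P x}, exists k, inhabited (hom (sval (r k)) (sval x)).
Proof.
have [K [r rP]] := gfinite S.
pose Q k := exists x : {x : S | P x}, inhabited (hom (r k) (sval x)).
exists {k : K | `[< Q k >]}, (fun k => projT1 (cid (elimT (asboolP _) (svalP k)))) => x.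
have [k kx] := rP (sval x).
have Qk : `[< Q k >] by apply/asboolP; exists x.
exists (exist _ k Qk); case: cid => y /= ky.
exact/(@isomorphic_trans _ (r k))/kx/isomorphic_sym.
Qed.

Definition full : groupoid := @Groupoid {x : S | P x}
  (fun x y => hom (sval x) (sval y))
  (fun x => gid (sval x)) (fun _ _ _ a b => gcomp a b) (fun _ _ a => ginv a)
  (fun _ _ _ _ => @gcompA S _ _ _ _) (fun _ _ => @gcomp1m S _ _)
  (fun _ _ => @gcompm1 S _ _) (fun _ _ => @gcompVm S _ _)
  (fun _ _ => @gcompmV S _ _) full_finite.

End FullSubgroupoid.

(* O(1) is encoded as [bool], as MathComp does for permutation signs: [false] *)
(* is +1 (even), [true] is -1 (odd), the product is [(+)].                    *)
Program Definition BO1 : groupoid := @Groupoid unit (fun _ _ => bool)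
  (fun _ => false) (fun _ _ _ a b => a (+) b) (fun _ _ a => a) _ _ _ _ _ _.
Next Obligation. exact: addbA. Qed.
Next Obligation. exact: addbF. Qed.
Next Obligation. exact: addbb. Qed.
Next Obligation. exact: addbb. Qed.
Next Obligation. by exists unit, id => x; exists x; exact: inhabits false. Qed.

Record pgroupoid := PGroupoid {
  carrier :> groupoid;
  par : functor carrier BO1
}.

Definition parity (X : pgroupoid) (x y : X) (a : hom x y) : bool :=
  fmap (par X) a.

Definition orientable (X : pgroupoid) (x : X) : Prop :=
  forall a : hom x x, parity a = false.

Definition orientable_part (X : pgroupoid) : groupoid := full (@orientable X).

(* Orientability is invariant under isomorphism, so the components of         *)
(* [orientable_part X] are the orientable components of [X]; hence            *)
(* [basepoints X n] is inhabited only when [X] has exactly [n] of them.       *)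
Record basepoints (X : pgroupoid) (n : nat) := Basepoints {
  bpoint :> 'I_n -> orientable_part X;
  bpointP : transversal bpoint
}.

Lemma basepoints_exist (X : pgroupoid) : exists n, inhabited (basepoints X n).
Proof.
have [K [r rP]] := transversal_exists (orientable_part X).
exists #|K|; apply: (inhabits (@Basepoints X #|K| (fun i => r (enum_val i)) _)).
move=> x; have [k [kx kI]] := rP x.
exists (enum_rank k); split=> [|i /kI ->]; first by rewrite enum_rankK.
exact: enum_valK.
Qed.

Record pspan (S T : pgroupoid) := PSpan {
  apex : groupoid;
  lleg : functor apex S;
  rleg : functor apex T;
  cell : natiso (fcomp lleg (par S)) (fcomp rleg (par T))
}.

Program Definition terminal : groupoid := @Groupoid unit (fun _ _ => unit)
  (fun _ => tt) (fun _ _ _ _ _ => tt) (fun _ _ _ => tt) _ _ _ _ _ _.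
Next Obligation. by case: a. Qed.
Next Obligation. by case: a. Qed.
Next Obligation. by exists unit, id => x; exists x; exact: inhabits tt. Qed.

Program Definition to_terminal (S : groupoid) : functor S terminal :=
  @Functor S terminal (fun _ => tt) (fun _ _ _ => tt) _ _.

Program Definition unit_parity : functor terminal BO1 :=
  @Functor terminal BO1 (fun _ => tt) (fun _ _ _ => false) _ _.

Definition pone : pgroupoid := PGroupoid unit_parity.

Definition scalar := pspan pone pone.

Definition scalar_card (S : scalar) : rat :=
  (gcard (full (fun s => cell S s = false))
   - gcard (full (fun s => cell S s = true)))%R.

Section Fibre.
Variables (I J : pgroupoid) (M : pspan I J) (i : I) (j : J).

Record fibre_ob := FibreOb {
  fpt : apex M;
  fin : hom i (lleg M fpt);
  fout : hom (rleg M fpt) j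
}.

Definition fibre_pred (x y : fibre_ob) (u : hom (fpt x) (fpt y)) : bool :=
  (gcomp (fin x) (fmap (lleg M) u) == fin y)
    && (gcomp (fmap (rleg M) u) (fout y) == fout x).

Definition fibre_hom (x y : fibre_ob) : finType :=
  {u : hom (fpt x) (fpt y) | fibre_pred u}.

Definition fibre_sign (x : fibre_ob) : bool :=
  parity (fin x) (+) cell M (fpt x) (+) parity (fout x).

Lemma fibre_id_subproof (x : fibre_ob) : fibre_pred (gid (fpt x)).
Proof. by rewrite /fibre_pred !fmap1 gcompm1 gcomp1m !eqxx. Qed.

Lemma fibre_comp_subproof (x y z : fibre_ob) (a : fibre_hom x y)
  (b : fibre_hom y z) : fibre_pred (gcomp (val a) (val b)).
Proof.
case: a b => [a /= /andP[/eqP a1 /eqP a2]] [b /= /andP[/eqP b1 /eqP b2]].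
by rewrite /fibre_pred !fmapM gcompA a1 b1 -gcompA b2 a2 !eqxx.
Qed.

Lemma fibre_inv_subproof (x y : fibre_ob) (a : fibre_hom x y) :
  fibre_pred (ginv (val a)).
Proof.
case: a => [a /= /andP[/eqP a1 /eqP a2]].
rewrite /fibre_pred -a1 -a2 -gcompA -fmapM gcompmV fmap1 gcompm1 eqxx /=.
by rewrite gcompA -fmapM gcompVm fmap1 gcomp1m.
Qed.

Lemma fibre_finite : exists (K : finType) (r : K -> fibre_ob),
  forall x, exists k, inhabited (fibre_hom (r k) x).
Proof.
have [K [r rP]] := gfinite (apex M).
pose T k : finType := (hom i (lleg M (r k)) * hom (rleg M (r k)) j)%type.
exists {k : K & T k}.
exists (fun k => FibreOb (tagged k).1 (tagged k).2) => -[m a b].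
have [k [u]] := rP m.
pose a' := gcomp a (ginv (fmap (lleg M) u)).
exists (Tagged T (a', gcomp (fmap (rleg M) u) b)).
split; exists u; rewrite /fibre_pred /= eqxx andbT /a'.
by rewrite -gcompA gcompVm gcompm1.
Qed.

Program Definition fibre_groupoid : groupoid := @Groupoid fibre_ob fibre_hom
  (fun x => exist _ _ (fibre_id_subproof x))
  (fun _ _ _ a b => exist _ _ (fibre_comp_subproof a b))
  (fun _ _ a => exist _ _ (fibre_inv_subproof a))
  _ _ _ _ _ fibre_finite.
Next Obligation. by apply: val_inj; exact: gcompA. Qed.
Next Obligation. by apply: val_inj; exact: gcomp1m. Qed.
Next Obligation. by apply: val_inj; exact: gcompm1. Qed.
Next Obligation. by apply: val_inj; exact: gcompVm. Qed.
Next Obligation. by apply: val_inj; exact: gcompmV. Qed.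

Lemma fibre_signP (x y : fibre_groupoid) (a : hom x y) :
  fibre_sign y = fibre_sign x.
Proof.
case: a => a /andP[/eqP a1 /eqP a2].
have := natural (cell M) a; rewrite /= => aN.
rewrite /fibre_sign -a1 -a2 /parity !fmapM /=.
by rewrite -!addbA; congr addb; rewrite addbA aN addbA.
Qed.

Lemma fibre_sign_natural (x y : fibre_groupoid) (a : hom x y) :
  false (+) fibre_sign y = fibre_sign x (+) false.
Proof. by rewrite (fibre_signP a) addbF. Qed.

Definition fibre : scalar :=
  let leg := to_terminal fibre_groupoid in
  @PSpan pone pone fibre_groupoid leg leg
    (@NatIso fibre_groupoid BO1 (fcomp leg (par pone)) (fcomp leg (par pone))
       fibre_sign fibre_sign_natural).

End Fibre.

Definition pspan_card (I J : pgroupoid) (m n : nat) (i : basepoints I m)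
    (j : basepoints J n) (M : pspan I J) : 'M[rat]_(m, n) :=
  \matrix_(k, l) (scalar_card (fibre M (sval (i k)) (sval (j l)))
                  / #|hom (j l) (j l)|%:R)%R.

Section WeakQuotient.
Variables (n : nat) (X : groupoid).

Implicit Types x y z : 'I_n -> X.

Definition wq_hom y x : finType :=
  {s : 'S_n & {dffun forall j : 'I_n, hom (y j) (x (s j))}}.

Definition wq_mk y x (s : 'S_n) (g : forall j, hom (y j) (x (s j))) :
  wq_hom y x := Tagged (fun s : 'S_n => {dffun forall j, hom (y j) (x (s j))})
                  (finfun g).

Definition wq_perm y x (a : wq_hom y x) : 'S_n := tag a.

Definition wq_arrow y x (a : wq_hom y x) j : hom (y j) (x (wq_perm a j)) :=
  tagged a j.

(* Transports of arrows along the equations [(s * t) j = t (s j)], [1 j = j]  *)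
(* and [s (s^-1 j) = j], which hold only propositionally.                     *)
Definition cast_tgt (u : X) x k l (e : k = l) (a : hom u (x k)) : hom u (x l) :=
  ecast k (hom u (x k)) e a.

Definition cast_src (v : X) y k l (e : k = l) (a : hom (y k) v) : hom (y l) v :=
  ecast k (hom (y k) v) e a.

Definition wq_id x : wq_hom x x :=
  wq_mk (fun j => cast_tgt (esym (perm1 j)) (gid (x j))).

Definition wq_comp x y z (a : wq_hom x y) (b : wq_hom y z) : wq_hom x z :=
  @wq_mk x z (wq_perm a * wq_perm b)%g (fun j =>
    cast_tgt (esym (permM _ _ j))
      (gcomp (wq_arrow a j) (wq_arrow b (wq_perm a j)))).

Definition wq_inv y x (a : wq_hom y x) : wq_hom x y :=
  @wq_mk x y (wq_perm a)^-1%g (fun j =>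
    cast_src (permKV (wq_perm a) j)
      (ginv (wq_arrow a ((wq_perm a)^-1%g j)))).

Definition wq_tag (u : X) x k (a : hom u (x k)) : {k & hom u (x k)} :=
  Tagged (fun k => hom u (x k)) a.

Lemma wq_tag_cast (u : X) x k l (e : k = l) (a : hom u (x k)) :
  wq_tag (cast_tgt e a) = wq_tag a.
Proof. by case: l / e. Qed.

Lemma wq_arrow_mk y x (s : 'S_n) (g : forall j, hom (y j) (x (s j))) j :
  wq_arrow (wq_mk g) j = g j.
Proof. by rewrite /wq_arrow /= ffunE. Qed.

Lemma wq_homP y x (a b : wq_hom y x) :
  (forall j, wq_tag (wq_arrow a j) = wq_tag (wq_arrow b j)) -> a = b.
Proof.
case: a b => [s f] [t g] ab.
have st : s = t by apply/permP => j; exact: (congr1 tag (ab j)).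
case: t / st g ab => g ab; congr existT; apply/ffunP => j.
exact: (eq_from_Tagged (ab j)).
Qed.

Lemma wq_tag_post (u v : X) x k l (e : k = l) (a : hom u v) (b : hom v (x k)) :
  wq_tag (gcomp a (cast_tgt e b)) = wq_tag (gcomp a b).
Proof. by case: l / e. Qed.

Lemma wq_tag_pre (u : X) y x (b : wq_hom y x) k l (e : k = l)
    (a : hom u (y k)) :
  wq_tag (gcomp (cast_tgt e a) (wq_arrow b l)) =
  wq_tag (gcomp a (wq_arrow b k)).
Proof. by case: l / e. Qed.

Lemma wq_tag_invl (u : X) x k l (e : k = l) (a : hom u (x k)) :
  wq_tag (gcomp (cast_src e (ginv a)) a) = wq_tag (gid (x l)).
Proof. by case: l / e; rewrite /= gcompVm. Qed.

Lemma wq_tag_invr y x (a : wq_hom y x) j k (e0 : k = j)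
    (e : wq_perm a k = wq_perm a j) :
  wq_tag (gcomp (wq_arrow a j) (cast_src e (ginv (wq_arrow a k)))) =
  wq_tag (gid (y j)).
Proof. by case: j / e0 e => e; rewrite eq_axiomK /= gcompmV. Qed.

Lemma wq_compA x y z t (a : wq_hom x y) (b : wq_hom y z) (c : wq_hom z t) :
  wq_comp a (wq_comp b c) = wq_comp (wq_comp a b) c.
Proof.
apply: wq_homP => j; rewrite !wq_arrow_mk !wq_tag_cast wq_tag_post gcompA.
exact/esym/wq_tag_pre.
Qed.

Lemma wq_comp1m y x (a : wq_hom y x) : wq_comp (wq_id y) a = a.
Proof.
apply: wq_homP => j; rewrite !wq_arrow_mk wq_tag_cast.
by rewrite [LHS]wq_tag_pre gcomp1m.
Qed.

Lemma wq_compm1 y x (a : wq_hom y x) : wq_comp a (wq_id x) = a.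
Proof.
apply: wq_homP => j.
by rewrite !wq_arrow_mk wq_tag_cast wq_tag_post gcompm1.
Qed.

Lemma wq_compVm y x (a : wq_hom y x) : wq_comp (wq_inv a) a = wq_id x.
Proof.
apply: wq_homP => j; rewrite !wq_arrow_mk !wq_tag_cast.
exact: wq_tag_invl.
Qed.

Lemma wq_compmV y x (a : wq_hom y x) : wq_comp a (wq_inv a) = wq_id y.
Proof.
apply: wq_homP => j; rewrite !wq_arrow_mk !wq_tag_cast.
exact/wq_tag_invr/permK.
Qed.

Lemma wq_finite : exists (K : finType) (r : K -> ('I_n -> X)),
  forall x, exists k, inhabited (wq_hom (r k) x).
Proof.
have [K [r rP]] := gfinite X.
exists {ffun 'I_n -> K}, (fun f : {ffun 'I_n -> K} => fun j => r (f j)) => x.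
have /choice[f fP] : forall j, exists k, inhabited (hom (r k) (x j)).
  by move=> j; exact: rP.
exists (finfun f); have g j : hom (r (finfun f j)) (x j).
  by rewrite ffunE; exact: inhabited_witness (fP j).
exact: inhabits (wq_mk (fun j => cast_tgt (esym (perm1 j)) (g j))).
Qed.

Definition wquot : groupoid :=
  Groupoid wq_compA wq_comp1m wq_compm1 wq_compVm wq_compmV wq_finite.

End WeakQuotient.

Section ExteriorPower.
Variable n : nat.

Lemma fmap_cast_tgt (S T : groupoid) (F : functor S T) (u : S) (x : 'I_n -> S)
    k l (e : k = l) (a : hom u (x k)) :
  fmap F (cast_tgt e a) = cast_tgt (x := fun j => F (x j)) e (fmap F a).
Proof. by case: l / e. Qed.

Program Definition wquot_functor (S T : groupoid) (F : functor S T) :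
    functor (wquot n S) (wquot n T) :=
  @Functor (wquot n S) (wquot n T) (fun x j => F (x j))
    (fun x y a => @wq_mk n T (fun j => F (x j)) (fun j => F (y j)) (wq_perm a)
                    (fun j => fmap F (wq_arrow a j))) _ _.
Next Obligation.
apply: wq_homP => j.
by rewrite /= !wq_arrow_mk fmap_cast_tgt !wq_tag_cast fmap1.
Qed.
Next Obligation.
apply: wq_homP => j.
by rewrite /= !wq_arrow_mk fmap_cast_tgt !wq_tag_cast fmapM.
Qed.

Section Parity.
Variable X : pgroupoid.

Definition wq_parity (x y : wquot n X) (a : hom x y) : bool :=
  odd_perm (wq_perm a) (+) \big[addb/false]_(j < n) parity (wq_arrow a j).

Lemma parity_cast_tgt (u : X) (x : 'I_n -> X) k l (e : k = l)
  (a : hom u (x k)) : parity (cast_tgt e a) = parity a.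
Proof. by case: l / e. Qed.

Lemma parity1 (x : X) : parity (gid x) = false.
Proof. exact: (fmap1 (par X)). Qed.

Lemma parityM (x y z : X) (a : hom x y) (b : hom y z) :
  parity (gcomp a b) = parity a (+) parity b.
Proof. exact: (fmapM (par X)). Qed.

Lemma wq_parity1 (x : wquot n X) : wq_parity (gid x) = false.
Proof.
rewrite /wq_parity odd_perm1 big1 // => j _.
by rewrite wq_arrow_mk parity_cast_tgt parity1.
Qed.

Lemma wq_parityM (x y z : wquot n X) (a : hom x y) (b : hom y z) :
  wq_parity (gcomp a b) = wq_parity a (+) wq_parity b.
Proof.
rewrite /wq_parity odd_permM.
under eq_bigr do rewrite wq_arrow_mk parity_cast_tgt parityM.
rewrite big_split /= addbACA; congr (_ (+) (_ (+) _)).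
by rewrite [RHS](reindex_inj (@perm_inj _ (wq_perm a))).
Qed.

Definition ext : pgroupoid :=
  @PGroupoid (wquot n X)
    (@Functor (wquot n X) BO1 (fun _ => tt) wq_parity wq_parity1 wq_parityM).

End Parity.

Section Span.
Variables (S T : pgroupoid) (M : pspan S T).

Definition ext_cell (m : wquot n (apex M)) : bool :=
  \big[addb/false]_(j < n) cell M (m j).

Lemma ext_cell_natural (x y : wquot n (apex M)) (a : hom x y) :
  wq_parity (X := S) (fmap (wquot_functor (lleg M)) a) (+) ext_cell y =
  ext_cell x (+) wq_parity (X := T) (fmap (wquot_functor (rleg M)) a).
Proof.
rewrite /wq_parity /= [RHS]addbCA -addbA; congr addb.
rewrite /ext_cell [X in _ (+) X](reindex_inj (@perm_inj _ (wq_perm a))) /=.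
rewrite -!big_split /=; apply: eq_bigr => j _; rewrite !wq_arrow_mk.
exact: (natural (cell M) (wq_arrow a j)).
Qed.

Definition ext_span : pspan (ext S) (ext T) :=
  @PSpan (ext S) (ext T) (wquot n (apex M))
    (wquot_functor (lleg M)) (wquot_functor (rleg M))
    (@NatIso (wquot n (apex M)) BO1
       (fcomp (wquot_functor (lleg M)) (par (ext S)))
       (fcomp (wquot_functor (rleg M)) (par (ext T)))
       ext_cell ext_cell_natural).

End Span.

End ExteriorPower.

Section ExteriorBasepoint.
Variables (X : pgroupoid) (n : nat) (x : basepoints X n).

Definition ext_bpoint : ext n X := fun j => sval (x j).

Lemma ext_hom_exists (y z : ext n X) (s : 'S_n) (f : 'I_n -> bool) :
  (forall j, exists g : hom (y j) (z (s j)), parity g = f j) ->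
  exists a : hom y z, parity a = odd_perm s (+) \big[addb/false]_j f j.
Proof.
move=> gP; pose g j := projT1 (cid (gP j)).
exists (wq_mk g); congr (_ (+) _); apply: eq_bigr => j _.
by rewrite wq_arrow_mk /g; case: cid.
Qed.

Lemma bpoint_inj j k : isomorphic (sval (x j)) (sval (x k)) -> j = k.
Proof.
move=> jk; have [l [_ lP]] := bpointP x (x k).
by rewrite -(lP j) // -(lP k) //; exact: isomorphic_refl.
Qed.

Lemma ext_bpoint_orientable : orientable ext_bpoint.
Proof.
move=> a; have s1 j : wq_perm a j = j.
  by apply/esym/bpoint_inj; exact: inhabits (wq_arrow a j).
rewrite /parity /= /wq_parity.
have /(congr1 (@odd_perm _)) -> : wq_perm a = 1%g.
  by apply/permP => j; rewrite s1 perm1.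
rewrite odd_perm1 big1 // => j _.
move: (wq_perm a j) (s1 j) (wq_arrow a j) => k -> b.
exact: (svalP (x j)).
Qed.

Lemma ext_orientable_comp (y : ext n X) : orientable y ->
  forall j, orientable (y j).
Proof.
move=> yo j a; have [k|b] := @ext_hom_exists y y 1%g
    (fun k => if k == j then parity a else false).
  rewrite perm1; case: eqVneq => [->|_]; first by exists a.
  by exists (gid (y k)); exact: parity1.
by rewrite yo odd_perm1 -big_mkcond big_pred1_eq.
Qed.

Lemma ext_orientable_inj (y : ext n X) : orientable y ->
  forall j k, isomorphic (y j) (y k) -> j = k.
Proof.
move=> yo j k [a]; apply/eqP/negPn/negP => jk.
have [l|b] := @ext_hom_exists y y (tperm j k)
    (fun l => if (l == j) || (l == k) then parity a else false).
  case: tpermP => [->|->|/eqP/negPf-> /eqP/negPf->].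
  - by rewrite eqxx; exists a.
  - rewrite eqxx orbT; exists (ginv a); have := parityM (ginv a) a.
    by rewrite gcompVm parity1; do 2!case: parity.
  - by exists (gid (y l)); exact: parity1.
rewrite yo odd_tperm jk -big_mkcond (bigD1 j) ?eqxx //= (bigD1 k) /=.
  rewrite big1 ?addbF ?addbb // => l /andP[/andP[/orP[]-> //]].
by rewrite eqxx orbT eq_sym.
Qed.

Lemma ext_bpoint_transversal :
  transversal (S := orientable_part (ext n X))
    (fun _ : 'I_1 => exist _ ext_bpoint ext_bpoint_orientable).
Proof.
move=> [y yo]; exists ord0; split=> [|k _]; last by rewrite [k]ord1.
have yO := ext_orientable_comp yo; have yI := ext_orientable_inj yo.
have /choice[s sP] : forall j, exists k, isomorphic (sval (x k)) (y j).
  by move=> j; have [k [kP _]] := bpointP x (exist _ (y j) (yO j)); exists k.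
have s_inj : injective s.
  move=> j k sjk; apply: yI; apply: isomorphic_trans (sP k).
  by rewrite -sjk; exact: isomorphic_sym.
apply: isomorphic_sym; have g j : hom (y j) (ext_bpoint (perm s_inj j)).
  by rewrite permE; exact: inhabited_witness (isomorphic_sym (sP j)).
exact: inhabits (wq_mk g).
Qed.

(* The orientable part of the top exterior power is connected.                *)
Definition ext_basepoints : basepoints (ext n X) 1 :=
  Basepoints ext_bpoint_transversal.

Definition Det (A : pspan X X) : pspan (ext n X) (ext n X) := ext_span n A.

Definition Det_card (A : pspan X X) : rat :=
  pspan_card ext_basepoints ext_basepoints (Det A) ord0 ord0.

End ExteriorBasepoint.

(* Main.v *)
(* The mass of a groupoid can be computed from any finite family of objects   *)
(* meeting all components, repetitions allowed: the object r_k weighs         *)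
(* 1 / d_k, with d_k the number of arrows from r_k into the family.  If (r_k) *)
(* is such a family for the apex of M, the objects r o f, f : {1..n} -> K,    *)
(* form one for its n-th exterior power, with d_f = n! prod_i d_(f i).        *)
(* Signed counts of arrows in an exterior power are determinants of signed    *)
(* counts of arrows, so the fibre of the exterior power has cardinality       *)
(*   1/n! sum_f det (L i (f j)) (prod_i w (f i)) det (P (f i) j),             *)
(* with L, P the signed counts for the two legs and w_k = sign(r_k) / d_k,    *)
(* and Cauchy-Binet identifies this with det (sum_k L i k * w_k * P k j), the *)
(* determinant of the cardinalities of the fibres of M.                       *)

From mathcomp Require Import all_boot all_order all_fingroup all_algebra.
From mathcomp Require Import boolp.
Require Import Defs.

Set Implicit Arguments.
Unset Strict Implicit.
Unset Printing Implicit Defensive.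

Import GRing.Theory Num.Theory.

Local Open Scope ring_scope.

(** The sign of the permutation in the parity of an exterior power turns permanents of arrow counts
    into determinants ([signed_homs_ext]). With [fibre_card_family] and [weighted_Cauchy_Binet] this
    gives the determinant formula for fibres at arbitrary tuples, [fibre_card_ext]. Base points come
    in at the end: they lie in distinct components, so the automorphism count of their tuple is the
    product of theirs ([card_ext_bpoint]), which is exactly what normalising the columns takes out
    of the determinant. *)

Definition sgr (b : bool) : rat := (-1) ^+ b.

Lemma sgrD (b c : bool) : sgr (b (+) c) = sgr b * sgr c.
Proof. exact: signr_addb. Qed.

(** Dependent distributivity, because the arrow sets [hom (y j) (x (s j))] vary with [j]. *)
Lemma bigA_distr_dffun (R : comPzSemiRingType) (I : finType) (T : I -> finType)
    (F : forall i, T i -> R) :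
  \prod_i \sum_(t : T i) F i t =
  \sum_(f : {dffun forall i, T i}) \prod_i F i (f i).
Proof.
rewrite (reindex (@dffun_of_fprod I T)) /=; last first.
  exact/onW_bij/dffun_of_fprod_bij.
under [RHS]eq_bigr do under eq_bigr do rewrite ffunE.
pose P i : {ffun T i -> R} := [ffun t => F i t].
under [RHS]eq_bigr => t _ do
  under eq_bigr => i _ do rewrite -[F i (t i)](ffunE (F i)) -/(P i).
rewrite (big_fprod 1 _ P).
rewrite -(bigA_distr_big_dep (tagged_with T) (fun i => untag 0 (P i))).
apply: eq_bigr => i _; rewrite -(big_tag (fun i => P i)).
by apply: eq_bigr => t _; rewrite ffunE.
Qed.

(** * Cardinalities computed from families of objects *)

Lemma card_hom_isomorphic (S : groupoid) (x x' y y' : S) :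
  isomorphic x x' -> isomorphic y y' -> #|hom x y| = #|hom x' y'|.
Proof.
move=> [a] [b]; apply: (@bij_eq_card _ _ (fun u => gcomp (gcomp (ginv a) u) b)).
exists (fun u => gcomp (gcomp a u) (ginv b)) => u.
  by rewrite -!gcompA gcompmV gcompm1 gcompA gcompmV gcomp1m.
by rewrite -!gcompA gcompVm gcompm1 gcompA gcompVm gcomp1m.
Qed.

Lemma card_hom0 (S : groupoid) (x y : S) :
  ~ isomorphic x y -> #|hom x y| = 0%N.
Proof. by move=> xy; apply: eq_card0 => a; case: xy. Qed.

Definition meets_components (S : groupoid) (K : Type) (r : K -> S) : Prop :=
  forall x, exists k, isomorphic (r k) x.

Definition family_degree (S : groupoid) (K : finType) (r : K -> S) (k : K) :
    nat :=
  \sum_l #|hom (r k) (r l)|.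

(* A component met [N] times contributes [N] terms [1 / (N * #|Aut|)].        *)
Lemma gcard_family (S : groupoid) (K : finType) (r : K -> S) :
  meets_components r -> gcard S = \sum_k (family_degree r k)%:R^-1.
Proof.
move=> rP.
have /choice[c cP] k : exists s, isomorphic (pi0_base s) (r k).
  by have [s [sk _]] := pi0_baseP (r k); exists s.
have cU s k : isomorphic (pi0_base s) (r k) -> c k = s.
  move=> sk; have [t [_ tU]] := pi0_baseP (r k).
  by rewrite -(tU _ sk) -(tU _ (cP k)).
rewrite (partition_big c predT) //=; apply: eq_bigr => s _.
have degE k : c k == s -> family_degree r k =
    (#|[pred l | c l == s]| * #|hom (pi0_base s) (pi0_base s)|)%N.
  move=> /eqP ks; rewrite /family_degree (bigID (fun l => c l == s)) /=.
  rewrite [X in (_ + X)%N]big1 ?addn0 => [|l /eqP lns]; last first.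
    apply: card_hom0 => kl; apply: lns; rewrite -ks; apply: cU.
    exact: isomorphic_trans kl.
  rewrite -sum_nat_const; apply: eq_bigr => l /eqP ls.
  apply: card_hom_isomorphic; apply: isomorphic_sym.
    by rewrite -{1}ks.
  by rewrite -{1}ls.
under eq_bigr => k ks do rewrite (degE k ks) natrM invfM.
rewrite sumr_const -mulrnAl -[X in X * _]mulr_natl divff ?mul1r //.
rewrite pnatr_eq0 -lt0n; apply/card_gt0P.
have [k /isomorphic_sym/cU ks] := rP (pi0_base s); exists k.
exact/eqP.
Qed.

(** No arrow joins objects with different values of [b], so degrees inside the full subgroupoid
    agree with those in [S]. *)
Lemma gcard_full_family (S : groupoid) (K : finType) (r : K -> S)
    (b : S -> bool) (c : bool) :
  meets_components r -> (forall x y, isomorphic x y -> b x = b y) ->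
  gcard (full (fun x => b x = c)) =
  \sum_(k | b (r k) == c) (family_degree r k)%:R^-1.
Proof.
move=> rP bI.
pose r' (k : {k | b (r k) == c}) : full (fun x => b x = c) :=
  exist _ (r (val k)) (eqP (valP k)).
rewrite (@gcard_family _ _ r') => [|[x xc]]; last first.
  have [k kx] := rP x; have kc : b (r k) == c by rewrite (bI _ _ kx) xc.
  by exists (exist _ k kc).
rewrite [RHS](big_sub (fun k => b (r k) == c)).
apply: eq_bigr => -[k kc] _; congr (_%:R^-1) => /=.
rewrite [RHS](bigID (fun l => b (r l) == c)) /= [X in (_ + X)%N]big1 ?addn0.
  by rewrite [RHS](big_sub (fun k => b (r k) == c)).
by move=> l lc; apply: card_hom0 => /bI kl; move: lc; rewrite -kl kc.
Qed.

Lemma scalar_card_family (S : scalar) (K : finType) (r : K -> apex S) :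
  meets_components r ->
  scalar_card S = \sum_k sgr (cell S (r k)) / (family_degree r k)%:R.
Proof.
move=> rP.
have bI (x y : apex S) : isomorphic x y -> cell S x = cell S y :> bool.
  by case=> a; have := natural (cell S) a; rewrite /= addbF.
rewrite /scalar_card !(gcard_full_family _ rP bI).
rewrite [RHS](bigID (fun k => (cell S (r k) : bool) == false)) /= -sumrN.
congr (_ + _).
  by apply: eq_bigr => k /eqP ->; rewrite mul1r.
apply: eq_big => [k|k /eqP->]; first by case: (cell S _ : bool).
by rewrite mulN1r.
Qed.

Definition signed_homs (X : pgroupoid) (x y : X) : rat :=
  \sum_(a : hom x y) sgr (parity a).

(** The triples [(r k, a, b)] with [a], [b] arbitrary meet every component of the fibre. For fixed
    [k] they have equal weights, and their signs factor into contributions of [a], [r k] and [b]. *)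
Lemma fibre_card_family (I J : pgroupoid) (M : pspan I J) (i : I) (j : J)
    (K : finType) (r : K -> apex M) :
  meets_components r ->
  scalar_card (fibre M i j) =
  \sum_k signed_homs i (lleg M (r k)) * sgr (cell M (r k))
         * signed_homs (rleg M (r k)) j / (family_degree r k)%:R.
Proof.
move=> rP.
pose T k : finType := (hom i (lleg M (r k)) * hom (rleg M (r k)) j)%type.
pose ob k (ab : T k) : fibre_ob M i j := FibreOb ab.1 ab.2.
pose r' (p : {k & T k}) : fibre_groupoid M i j := ob (tag p) (tagged p).
have r'P : meets_components r'.
  move=> [m a b]; have [k [u]] := rP m.
  pose a' := gcomp a (ginv (fmap (lleg M) u)).
  exists (Tagged T (a', gcomp (fmap (rleg M) u) b)).
  split; exists u; rewrite /fibre_pred /= eqxx andbT /a'.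
  by rewrite -gcompA gcompVm gcompm1.
(* Each [u] from [r k] to [r l] underlies exactly one fibre arrow out of [(r k, a, b)]: its target
   must carry [a] followed by [u], and the inverse of [u] followed by [b]. *)
have degE p : family_degree r' p = family_degree r (tag p).
  rewrite /family_degree -(sig_big_dep predT (fun _ _ => true)
    (fun l (ab : T l) => #|fibre_hom (r' p) (ob l ab)|)).
  apply: eq_bigr => l _.
  under eq_bigr => ab _ do rewrite card_sig -sum1_card big_mkcond /=.
  rewrite exchange_big /= -sum1_card; apply: eq_bigr => u _.
  rewrite (bigD1 (gcomp (tagged p).1 (fmap (lleg M) u),
                  gcomp (ginv (fmap (rleg M) u)) (tagged p).2)) //=.
  rewrite big1 => [|[a b] ab].
    by rewrite inE /fibre_pred /= gcompA gcompmV gcomp1m !eqxx.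
  rewrite inE /fibre_pred /=; case: andP => // -[/eqP a1 /eqP b1].
  by move: ab; rewrite -a1 -b1 gcompA gcompVm gcomp1m eqxx.
rewrite (@scalar_card_family (fibre M i j) _ _ r'P).
under eq_bigr => p _ do rewrite degE.
rewrite -(sig_big_dep predT (fun _ _ => true) (fun k (ab : T k) =>
   sgr (fibre_sign (ob k ab)) / (family_degree r k)%:R)).
apply: eq_bigr => k _; rewrite -mulr_suml; congr (_ / _).
rewrite mulrAC mulr_suml -(pair_bigA _ (fun a b => sgr (fibre_sign (ob k (a, b))))).
rewrite mulr_suml /=; apply: eq_bigr => a _.
rewrite mulr_sumr mulr_suml; apply: eq_bigr => b _.
by rewrite /fibre_sign !sgrD /= mulrAC.
Qed.

(** * Arrow counts in exterior powers *)

(** Trivial [w] and [F] give a permanent ([card_wq_hom]), signs give a determinant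
    ([signed_homs_ext]). *)
Lemma sum_wq_hom (n : nat) (X : groupoid) (y x : 'I_n -> X) (w : 'S_n -> rat)
    (F : forall u v : X, hom u v -> rat) :
  \sum_(a : wq_hom y x) w (wq_perm a) * \prod_j F _ _ (wq_arrow a j) =
  \sum_s w s * \prod_j \sum_(g : hom (y j) (x (s j))) F _ _ g.
Proof.
under [RHS]eq_bigr do rewrite bigA_distr_dffun mulr_sumr.
by rewrite (sig_big_dep predT (fun _ _ => true) (fun (s : 'S_n)
  (g : {dffun forall j, hom (y j) (x (s j))}) => w s * \prod_j F _ _ (g j))).
Qed.

Lemma card_wq_hom (n : nat) (X : groupoid) (y x : 'I_n -> X) :
  #|wq_hom y x|%:R = \sum_(s : 'S_n) \prod_j (#|hom (y j) (x (s j))|%:R : rat).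
Proof.
have := sum_wq_hom y x (fun=> 1) (fun _ _ _ => 1).
rewrite big1_eq mulr1 sumr_const => ->; apply: eq_bigr => s _; rewrite mul1r.
by apply: eq_bigr => j _; rewrite sumr_const.
Qed.

Lemma sgr_sum (n : nat) (F : 'I_n -> bool) :
  sgr (\big[addb/false]_j F j) = \prod_j sgr (F j).
Proof. exact: (big_morph sgr sgrD). Qed.

Section WeakQuotientFamily.
Variables (n : nat) (X : groupoid) (K : finType) (r : K -> X).

Definition wq_family (f : {ffun 'I_n -> K}) : wquot n X := fun j => r (f j).

Lemma wq_family_meets : meets_components r -> meets_components wq_family.
Proof.
move=> rP x.
have /choice[f fP] : forall j, exists k, isomorphic (r k) (x j).
  by move=> j; exact: rP.
exists (finfun f); have g j : hom (r (finfun f j)) (x j).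
  by rewrite ffunE; exact: inhabited_witness (fP j).
exact: inhabits (wq_mk (fun j => cast_tgt (esym (perm1 j)) (g j))).
Qed.

(** The target runs over all functions [g], so replacing [g] by its composite with [s] makes every
    permutation contribute the same product of degrees. *)
Lemma wq_family_degree (f : {ffun 'I_n -> K}) :
  (family_degree wq_family f)%:R =
  n`!%:R * \prod_j (family_degree r (f j))%:R :> rat.
Proof.
rewrite [in LHS]/family_degree natr_sum.
under eq_bigr do rewrite card_wq_hom.
rewrite exchange_big /= -card_Sn -sum1_card natr_sum mulr_suml.
apply: eq_big => [s|s _]; first by rewrite inE.
rewrite mul1r; under [RHS]eq_bigr do rewrite natr_sum.
rewrite bigA_distr_bigA.
rewrite [RHS](reindex (fun g : {ffun 'I_n -> K} => [ffun j => g (s j)])) /=.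
  by apply: eq_bigr => g _; apply: eq_bigr => j _; rewrite ffunE.
exists (fun g : {ffun 'I_n -> K} => [ffun j => g ((s^-1)%g j)]) => g _;
  by apply/ffunP => j; rewrite !ffunE ?permK ?permKV.
Qed.

End WeakQuotientFamily.

(** Summing over all functions rather than subsets produces the factor [n!]. In the Leibniz
    expansion of the first determinant, permuting [f] by [s] turns the sign into a row permutation
    of the second, so all [s] contribute equally. *)
Lemma weighted_Cauchy_Binet (R : comPzRingType) (n : nat) (K : finType)
    (L : 'I_n -> K -> R) (w : K -> R) (P : K -> 'I_n -> R) :
  \sum_(f : {ffun 'I_n -> K}) \det (\matrix_(i, j) L i (f j))
    * (\prod_i w (f i)) * \det (\matrix_(i, j) P (f i) j) =
  n`!%:R * \det (\matrix_(i, j) \sum_k L i k * w k * P k j).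
Proof.
pose D (f : {ffun 'I_n -> K}) := \det (\matrix_(i, j) P (f i) j).
transitivity (\sum_(s : 'S_n) \sum_(f : {ffun 'I_n -> K})
    (\prod_i (L i (f i) * w (f i))) * D f).
  rewrite [LHS](eq_bigr (fun f : {ffun 'I_n -> K} => \sum_(s : 'S_n)
      (-1) ^+ s * (\prod_i L i (f (s i))) * (\prod_i w (f i)) * D f)); last first.
    move=> f _; rewrite -!mulr_suml; congr (_ * _ * _).
    apply: eq_bigr => s _; congr (_ * _).
    by apply: eq_bigr => i _; rewrite mxE.
  rewrite exchange_big /=; apply: eq_bigr => s _.
  rewrite [RHS](reindex (fun f : {ffun 'I_n -> K} => [ffun i => f (s i)])) /=;
    last first.
    exists (fun f : {ffun 'I_n -> K} => [ffun i => f ((s^-1)%g i)]) => f _;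
      by apply/ffunP => i; rewrite !ffunE ?permK ?permKV.
  apply: eq_bigr => f _; rewrite big_split /=.
  have -> : D [ffun i => f (s i)] = (-1) ^+ s * D f.
    rewrite /D -[in RHS]det_perm -det_mulmx -row_permE; congr (\det _).
    by apply/matrixP => i j; rewrite !mxE ffunE.
  under [X in _ = X * _ * _]eq_bigr do rewrite ffunE.
  under [X in _ = _ * X * _]eq_bigr do rewrite ffunE.
  rewrite [X in _ * X * D f](reindex_inj (@perm_inj _ s)) /=.
  by rewrite -!mulrA mulrCA; congr (_ * _); rewrite mulrCA.
rewrite sumr_const card_Sn [RHS]mulr_natl; congr (_ *+ _).
(* What remains is multilinearity: both sides are expanded over a permutation [t] and a function
   [f]. *)
under eq_bigr do rewrite mulr_sumr.
rewrite exchange_big /=; apply: eq_bigr => t _.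
under [in RHS]eq_bigr do rewrite mxE.
rewrite bigA_distr_bigA mulr_sumr; apply: eq_bigr => f _.
rewrite mulrCA; congr (_ * _); rewrite -big_split /=.
by apply: eq_bigr => i _; rewrite mxE.
Qed.

Lemma signed_homs_ext (n : nat) (X : pgroupoid) (y x : ext n X) :
  signed_homs y x = \det (\matrix_(i, j) signed_homs (y i) (x j)).
Proof.
transitivity (\sum_(s : 'S_n) sgr s * \prod_j signed_homs (y j) (x (s j))).
  rewrite -(sum_wq_hom y x (fun s => sgr s) (fun u v g => sgr (parity g))).
  by apply: eq_bigr => a _; rewrite {1}/parity /= /wq_parity sgrD sgr_sum.
apply: eq_bigr => s _; congr (_ * _).
by apply: eq_bigr => j _; rewrite mxE.
Qed.

(** * Determinants of fibre cardinalities *)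

Lemma fibre_card_ext (n : nat) (S T : pgroupoid) (M : pspan S T) (x : ext n S)
    (y : ext n T) :
  scalar_card (fibre (ext_span n M) x y) =
  \det (\matrix_(i, j) scalar_card (fibre M (x i) (y j))).
Proof.
have [K [r rP]] := gfinite (apex M).
rewrite (@fibre_card_family _ _ (ext_span n M) x y _ _ (wq_family_meets rP)).
pose w k := sgr (cell M (r k)) / (family_degree r k)%:R.
have nf0 : n`!%:R != 0 :> rat by rewrite pnatr_eq0 -lt0n fact_gt0.
(* This [n!] cancels the one in [wq_family_degree] and supplies the one in
   [weighted_Cauchy_Binet]. *)
apply: (mulfI nf0); rewrite mulr_sumr.
have -> : \matrix_(i, j) scalar_card (fibre M (x i) (y j)) =
    \matrix_(i, j) \sum_k signed_homs (x i) (lleg M (r k)) * w k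
                        * signed_homs (rleg M (r k)) (y j).
  apply/matrixP => i j; rewrite !mxE (fibre_card_family _ _ rP).
  by apply: eq_bigr => k _; rewrite /w mulrA [RHS]mulrAC.
rewrite -(weighted_Cauchy_Binet (fun i k => signed_homs (x i) (lleg M (r k))) w
  (fun k j => signed_homs (rleg M (r k)) (y j))).
apply: eq_bigr => f _; rewrite !signed_homs_ext wq_family_degree /= /ext_cell.
rewrite sgr_sum big_split /= prodfV invfM mulrCA mulVKf // mulrAC.
by rewrite !mulrA.
Qed.

(** Base points in distinct components are not isomorphic, so in the permanent only the identity
    permutation survives. *)
Lemma card_ext_bpoint (X : pgroupoid) (n : nat) (x : basepoints X n) :
  #|hom (ext_basepoints x ord0) (ext_basepoints x ord0)|%:R =
  \prod_j (#|hom (x j) (x j)|%:R : rat).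
Proof.
rewrite [LHS](card_wq_hom (ext_bpoint x) (ext_bpoint x)).
rewrite (bigD1 1%g) //= [X in _ + X]big1 ?addr0 => [|s s1].
  by apply: eq_bigr => j _; rewrite perm1.
have [j sj] : exists j, s j != j.
  apply/existsP; apply: contraR s1 => /existsPn sE.
  by apply/eqP/permP => j; rewrite perm1; apply/eqP/negPn/sE.
rewrite (bigD1 j) //= card_hom0 ?mul0r // => /bpoint_inj jE.
by rewrite -jE eqxx in sj.
Qed.

Theorem corollary4p3p7 (X : pgroupoid) (n : nat) (x : basepoints X n)
    (A : pspan X X) :
  Det_card x A = (\det (pspan_card x x A))%R.
Proof.
rewrite /Det_card mxE card_ext_bpoint fibre_card_ext.
(* Dividing column [j] by the order of the automorphism group of [x j] is right multiplication by a
   diagonal matrix. *)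
pose v := \row_j (#|hom (x j) (x j)|%:R : rat)^-1.
have -> : pspan_card x x A =
    (\matrix_(i, j) scalar_card (fibre A (sval (x i)) (sval (x j)))) *m diag_mx v.
  by apply/matrixP => i j; rewrite mul_mx_diag !mxE.
rewrite det_mulmx det_diag -prodfV; congr (_ * _).
by apply: eq_bigr => j _; rewrite mxE.
Qed.
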